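(* Let $\mathsf A$ be an abelian category with enough projectives and let $C=(C^{i,j},d=d_h+d_v)$ be a bicomplex over $\mathsf A$ supported on the upper half-plane $(i,j)\in\mathbb Z\times\mathbb N$ whose total direct sum complex exists in $\mathsf A$. Let $E_1^{i,j}=H^{i,j}(C,d_v)$ be the vertical cohomology. Suppose that each $E_1^{i,j}$ is projective and that there exist an integer $a$ and a strictly decreasing sequence of integers $i_a>i_{a-1}>\cdots$ (indexed by all integers $\le a$) such that $E_1^{i,j}=0$ for * $i>i_a$ and all $j$, and for * $i+j\ne n$ when $i_{n-1}<i\le i_n$. Then: (1) for each integer $n$, the direct sum $P^n=\bigoplus_{i+j=n}E_1^{i,j}$ exists and is projective in $\mathsf A$ (and $P^n=0$ if $n>a$); (2) there exist morphisms $\{\partial^n\colon P^n\to P^{n+1}\}_{n\in\mathbb Z}$ with $\partial^{n+1}\partial^n=0$, so that $P=(P^n,\partial^n)$ is a complex in $\mathsf K^-(\mathbb P\mathsf A)$; (3) there exists a quasi-isomorphism $\psi=\{\psi^n\}_{n\in\mathbb Z}\colon P\to C$, where $C$ is viewed as its total complex. In particular, $\psi\colon P\to C$ constitutes a projective resolution of $C$.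
   Context: Complexes are graded cohomologically. $d_h^{i,j}\colon C^{i,j}\to C^{i+1,j}$ and $d_v^{i,j}\colon C^{i,j}\to C^{i,j+1}$ are the horizontal and vertical components of the differential. The total complex has terms $C^n=\bigoplus_{i+j=n}C^{i,j}$ (countable direct sums, assumed to exist in $\mathsf A$) and differential $d$. Filtering by column degree, the resulting spectral sequence $E_1^{i,j}=H^{i,j}(C,d_v)\Rightarrow H^{i+j}(C)$ converges to the cohomology of $C$ (part of the setting). $\mathsf K^-(\mathbb P\mathsf A)$ is the homotopy category of complexes of projectives of $\mathsf A$ that are bounded in the direction of the differential (bounded above). A projective resolution of a complex $C$ is a quasi-isomorphism $P\to C$ with $P\in\mathsf K^-(\mathbb P\mathsf A)$. *)

(* Defs.v *)
From mathcomp Require Import all_boot all_order all_algebra.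
Set Implicit Arguments.
Unset Strict Implicit.
Unset Printing Implicit Defensive.
Import Order.TTheory GRing.Theory Num.Theory.
Local Open Scope ring_scope.

Declare Scope cat_scope.
Delimit Scope cat_scope with cat.

Record preadditive := Preadditive {
  Ob :> Type;
  Mor : Ob -> Ob -> zmodType;
  id_mor : forall X, Mor X X;
  mcomp : forall X Y Z, Mor Y Z -> Mor X Y -> Mor X Z;
  comp_idl : forall X Y (f : Mor X Y), mcomp (id_mor Y) f = f;
  comp_idr : forall X Y (f : Mor X Y), mcomp f (id_mor X) = f;
  comp_assoc : forall W X Y Z (h : Mor Y Z) (g : Mor X Y) (f : Mor W X),
    mcomp h (mcomp g f) = mcomp (mcomp h g) f;
  comp_addl : forall X Y Z (g g' : Mor Y Z) (f : Mor X Y),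
    mcomp (g + g') f = mcomp g f + mcomp g' f;
  comp_addr : forall X Y Z (g : Mor Y Z) (f f' : Mor X Y),
    mcomp g (f + f') = mcomp g f + mcomp g f' }.

Arguments Mor {_} _ _.
Arguments id_mor {_} _.
Arguments mcomp {_ _ _ _} _ _.
Notation "g ∘ f" := (mcomp g f) (at level 40, left associativity) : cat_scope.
Open Scope cat_scope.

Section Preadditive.
Variable A : preadditive.
Implicit Types X Y Z W : A.

Definition is_zero X : Prop :=
  forall Y, (forall f : Mor X Y, f = 0) /\ (forall f : Mor Y X, f = 0).

Definition is_mono X Y (f : Mor X Y) : Prop :=
  forall W (g h : Mor W X), f ∘ g = f ∘ h -> g = h.

Definition is_epi X Y (f : Mor X Y) : Prop :=
  forall W (g h : Mor Y W), g ∘ f = h ∘ f -> g = h.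

Definition is_iso X Y (f : Mor X Y) : Prop :=
  exists g : Mor Y X, g ∘ f = id_mor X /\ f ∘ g = id_mor Y.

Definition is_kernel X Y (f : Mor X Y) K (k : Mor K X) : Prop :=
  f ∘ k = 0 /\
  forall W (g : Mor W X), f ∘ g = 0 -> exists! h : Mor W K, k ∘ h = g.

Definition is_cokernel X Y (f : Mor X Y) Q (q : Mor Y Q) : Prop :=
  q ∘ f = 0 /\
  forall W (g : Mor Y W), g ∘ f = 0 -> exists! h : Mor Q W, h ∘ q = g.

Definition is_biproduct X Y S (i1 : Mor X S) (i2 : Mor Y S)
    (p1 : Mor S X) (p2 : Mor S Y) : Prop :=
  [/\ p1 ∘ i1 = id_mor X, p2 ∘ i2 = id_mor Y, p1 ∘ i2 = 0, p2 ∘ i1 = 0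
    & i1 ∘ p1 + i2 ∘ p2 = id_mor S].

Definition projective P : Prop :=
  forall X Y (e : Mor X Y), is_epi e ->
  forall f : Mor P Y, exists g : Mor P X, e ∘ g = f.

Definition enough_projectives : Prop :=
  forall X, exists P (e : Mor P X), projective P /\ is_epi e.

Record direct_sum (I : Type) (X : I -> A) := DirectSum {
  ds_ob :> A;
  ds_in : forall i, Mor (X i) ds_ob;
  ds_desc : forall W, (forall i, Mor (X i) W) -> Mor ds_ob W;
  ds_descE : forall W (f : forall i, Mor (X i) W) i,
    ds_desc f ∘ ds_in i = f i;
  ds_ext : forall W (g h : Mor ds_ob W),
    (forall i, g ∘ ds_in i = h ∘ ds_in i) -> g = h }.

Lemma comp0l X Y Z (f : Mor X Y) : (0 : Mor Y Z) ∘ f = 0.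
Proof. by apply: (addrI ((0 : Mor Y Z) ∘ f)); rewrite -comp_addl !addr0. Qed.

Lemma comp0r X Y Z (g : Mor Y Z) : g ∘ (0 : Mor X Y) = 0.
Proof. by apply: (addrI (g ∘ (0 : Mor X Y))); rewrite -comp_addr !addr0. Qed.

Lemma is_kernel_mono X Y (f : Mor X Y) K (k : Mor K X) :
  is_kernel f k -> is_mono k.
Proof.
move=> [fk0 kP] W g h kgh.
have [|u [_ uU]] := kP W (k ∘ g); first by rewrite comp_assoc fk0 comp0l.
by rewrite -(uU g erefl) -(uU h (esym kgh)).
Qed.

End Preadditive.

Record abelian_category := Abelian {
  ab_cat :> preadditive;
  ab_zero : exists X : ab_cat, is_zero X;
  ab_biprod : forall X Y : ab_cat, exists (S : ab_cat)
    (i1 : Mor X S) (i2 : Mor Y S) (p1 : Mor S X) (p2 : Mor S Y),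
    is_biproduct i1 i2 p1 p2;
  kernel : forall X Y : ab_cat, Mor X Y -> ab_cat;
  kernel_in : forall (X Y : ab_cat) (f : Mor X Y), Mor (kernel f) X;
  kernelP : forall (X Y : ab_cat) (f : Mor X Y), is_kernel f (kernel_in f);
  cokernel : forall X Y : ab_cat, Mor X Y -> ab_cat;
  cokernel_pr : forall (X Y : ab_cat) (f : Mor X Y), Mor Y (cokernel f);
  cokernelP : forall (X Y : ab_cat) (f : Mor X Y), is_cokernel f (cokernel_pr f);
  mono_normal : forall (X Y : ab_cat) (f : Mor X Y), is_mono f ->
    exists (Z : ab_cat) (g : Mor Y Z), is_kernel g f;
  epi_normal : forall (X Y : ab_cat) (f : Mor X Y), is_epi f ->
    exists (W : ab_cat) (g : Mor W X), is_cokernel g f }.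

Section Subobjects.
Variable A : abelian_category.
Implicit Types X Y W : A.

Record subobject X := Subobject {
  sub_ob :> A;
  sub_in : Mor sub_ob X;
  sub_mono : is_mono sub_in }.

(* [sub_mem S x]: the generalized element [x] of [X] lies in [S]. *)
Definition sub_mem X (S : subobject X) W (x : Mor W X) : Prop :=
  exists y : Mor W S, sub_in S ∘ y = x.

Definition sub_le X (S S' : subobject X) : Prop := sub_mem S' (sub_in S).

Definition is_sub_inf X (I : Type) (F : I -> subobject X) (S : subobject X) :=
  (forall i, sub_le S (F i)) /\
  (forall S', (forall i, sub_le S' (F i)) -> sub_le S' S).

Definition is_sub_sup X (I : Type) (F : I -> subobject X) (S : subobject X) :=
  (forall i, sub_le (F i) S) /\
  (forall S', (forall i, sub_le (F i) S') -> sub_le S S').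

Definition sub_ker X Y (f : Mor X Y) : subobject X :=
  Subobject (is_kernel_mono (kernelP f)).

Definition sub_img X Y (f : Mor X Y) : subobject Y := sub_ker (cokernel_pr f).

Definition sub_bot X : subobject X := sub_img (0 : Mor X X).
Definition sub_top X : subobject X := sub_img (id_mor X).

Definition sub_direct X Y (f : Mor X Y) (S : subobject X) : subobject Y :=
  sub_img (f ∘ sub_in S).

(* f^-1(S), the kernel of X -> Y -> Y/S *)
Definition sub_inverse X Y (f : Mor X Y) (S : subobject Y) : subobject X :=
  sub_ker (cokernel_pr (sub_in S) ∘ f).

Definition sub_meet X (S S' : subobject X) : subobject X :=
  sub_direct (sub_in S) (sub_inverse (sub_in S) S').

(* S / S', to be used when S' is contained in S *)
Definition quo X (S S' : subobject X) : A :=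
  cokernel (sub_in (sub_inverse (sub_in S) S')).

Definition quo_pr X (S S' : subobject X) : Mor S (quo S S') :=
  cokernel_pr (sub_in (sub_inverse (sub_in S) S')).

End Subobjects.

Section Complexes.
Variable A : abelian_category.

Record complex := Complex {
  cx_ob :> int -> A;
  cx_d : forall n, Mor (cx_ob n) (cx_ob (n + 1));
  cx_dd : forall n, cx_d (n + 1) ∘ cx_d n = 0 }.

(* The differential into degree [n], transported along [n - 1 + 1 = n]. *)
Definition cx_d_to (K : complex) (n : int) : Mor (K (n - 1)) (K n) :=
  ecast m (Mor (K (n - 1)) (K m)) (subrK 1 n) (cx_d K (n - 1)).

Definition cycles (K : complex) (n : int) : subobject (K n) :=
  sub_ker (cx_d K n).

Definition boundaries (K : complex) (n : int) : subobject (K n) :=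
  sub_img (cx_d_to K n).

Definition cohomology (K : complex) (n : int) : A :=
  quo (cycles K n) (boundaries K n).

Definition coh_class (K : complex) (n : int) :
    Mor (cycles K n) (cohomology K n) :=
  quo_pr (cycles K n) (boundaries K n).

Record chain_map (K L : complex) := ChainMap {
  cmap :> forall n, Mor (K n) (L n);
  cmapE : forall n, cmap (n + 1) ∘ cx_d K n = cx_d L n ∘ cmap n }.

(* [phi] is the morphism that [f] induces in cohomology of degree [n]. *)
Definition induced_in_cohomology (K L : complex) (f : chain_map K L) (n : int)
    (phi : Mor (cohomology K n) (cohomology L n)) : Prop :=
  exists z : Mor (cycles K n) (cycles L n),
    sub_in (cycles L n) ∘ z = f n ∘ sub_in (cycles K n) /\
    phi ∘ coh_class K n = coh_class L n ∘ z.

Definition quasi_iso (K L : complex) (f : chain_map K L) : Prop :=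
  forall n, exists phi : Mor (cohomology K n) (cohomology L n),
    induced_in_cohomology f phi /\ is_iso phi.

(* The objects of K^-(P A). *)
Definition bounded_above_projective (P : complex) : Prop :=
  (forall n, projective (P n)) /\
  (exists N : int, forall n, N < n -> is_zero (P n)).

Definition projective_resolution (P K : complex) (f : chain_map P K) : Prop :=
  bounded_above_projective P /\ quasi_iso f.

Section Filtered.
(* A decreasing filtration of [K] by subcomplexes. *)
Variables (K : complex) (F : forall p n : int, subobject (K n)).

Definition mod_pr (p n : int) : Mor (K n) (cokernel (sub_in (F (p + 1) n))) :=
  cokernel_pr (sub_in (F (p + 1) n)).

(* [E_r = ss_Z r / ss_B r], both being subobjects of
   [F^p K^n / F^(p+1) K^n], which is itself contained in
   [K^n / F^(p+1) K^n]; here [n] is the total degree. *)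
Definition ss_Z (p n : int) (r : nat) :=
  sub_direct (mod_pr p n)
    (sub_meet (F p n) (sub_inverse (cx_d K n) (F (p + r%:Z) (n + 1)))).

Definition ss_B (p n : int) (r : nat) :=
  sub_direct (mod_pr p n)
    (sub_meet (F p n) (sub_direct (cx_d_to K n) (F (p - r%:Z + 1) (n - 1)))).

(* F^p H^n(K), the image of H^n(F^p K) in H^n(K) *)
Definition coh_fil (p n : int) : subobject (cohomology K n) :=
  sub_direct (coh_class K n) (sub_inverse (sub_in (cycles K n)) (F p n)).

(* [E_oo = Zoo / Boo] is mapped isomorphically onto [gr^p H^n(K)] by sending
   the class of a cocycle in [F^p K^n] to its cohomology class. *)
Definition ss_weakly_converges : Prop :=
  forall p n : int,
  exists Zoo Boo : subobject (cokernel (sub_in (F (p + 1) n))),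
  [/\ is_sub_inf (ss_Z p n) Zoo, is_sub_sup (ss_B p n) Boo
    & exists phi : Mor (quo Zoo Boo) (quo (coh_fil p n) (coh_fil (p + 1) n)),
      is_iso phi /\
      forall (W : A) (x : Mor W (cycles K n))
             (z : Mor W Zoo) (h : Mor W (coh_fil p n)),
        sub_mem (F p n) (sub_in (cycles K n) ∘ x) ->
        sub_in Zoo ∘ z = mod_pr p n ∘ (sub_in (cycles K n) ∘ x) ->
        sub_in (coh_fil p n) ∘ h = coh_class K n ∘ x ->
        phi ∘ (quo_pr Zoo Boo ∘ z) =
          quo_pr (coh_fil p n) (coh_fil (p + 1) n) ∘ h].

Definition ss_converges : Prop :=
  [/\ ss_weakly_converges,
      forall n, is_sub_sup (coh_fil^~ n) (sub_top (cohomology K n))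
    & forall n, is_sub_inf (coh_fil^~ n) (sub_bot (cohomology K n))].

End Filtered.

(* [bi_hh], [bi_vv] and [bi_hv] say that [d = d_h + d_v] has square zero. *)
Record bicomplex := Bicomplex {
  bi_ob :> int -> int -> A;
  bi_h : forall i j, Mor (bi_ob i j) (bi_ob (i + 1) j);
  bi_v : forall i j, Mor (bi_ob i j) (bi_ob i (j + 1));
  bi_hh : forall i j, bi_h (i + 1) j ∘ bi_h i j = 0;
  bi_vv : forall i j, bi_v i (j + 1) ∘ bi_v i j = 0;
  bi_hv : forall i j,
    bi_h i (j + 1) ∘ bi_v i j + bi_v (i + 1) j ∘ bi_h i j = 0 }.

Definition upper_half_plane (C : bicomplex) : Prop :=
  forall i j : int, j < 0 -> is_zero (C i j).

Definition column (C : bicomplex) (i : int) : complex := Complex (bi_vv C i).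

(* E_1^{i,j} *)
Definition vert_coh (C : bicomplex) (i j : int) : A := cohomology (column C i) j.

Record diag (n : int) := Diag { dcol : int; drow : int; diagE : dcol + drow = n }.

Fact diag_hE n (q : diag n) : dcol q + 1 + drow q = n + 1.
Proof. by rewrite addrAC diagE. Qed.

Fact diag_vE n (q : diag n) : dcol q + (drow q + 1) = n + 1.
Proof. by rewrite addrA diagE. Qed.

Definition diag_h n (q : diag n) : diag (n + 1) := Diag (diag_hE q).
Definition diag_v n (q : diag n) : diag (n + 1) := Diag (diag_vE q).

Section Total.
Variables (C : bicomplex)
  (S : forall n : int, direct_sum (fun q : diag n => C (dcol q) (drow q))).

Definition tot_d (n : int) : Mor (S n) (S (n + 1)) :=
  ds_desc (S n) (fun q : diag n =>
    ds_in (S (n + 1)) (diag_h q) ∘ bi_h C (dcol q) (drow q) +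
    ds_in (S (n + 1)) (diag_v q) ∘ bi_v C (dcol q) (drow q)).

Fact tot_dd (n : int) : tot_d (n + 1) ∘ tot_d n = 0.
Proof.
apply: ds_ext => q; rewrite comp0l -comp_assoc /tot_d (ds_descE (S n)).
rewrite comp_addr !comp_assoc !(ds_descE (S (n + 1))) /= !comp_addl.
rewrite -!comp_assoc bi_hh bi_vv !comp0r add0r addr0.
rewrite /diag_h /diag_v /= -[diag_hE (Diag _)]/(diag_hE (diag_v q)).
rewrite (eq_irrelevance (diag_hE (diag_v q)) (diag_vE (diag_h q))).
by rewrite -comp_addr (addrC (bi_v C _ _ ∘ _)) bi_hv comp0r.
Qed.

Definition total_complex : complex := Complex tot_dd.

(* F^p C^n, the sum of the C^{i,j} with i >= p: the image of the idempotent
   of [S n] that kills the columns of index < p *)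
Definition column_filtration (p n : int) : subobject (total_complex n) :=
  sub_img (ds_desc (S n) (fun q : diag n =>
    if p <= dcol q then ds_in (S n) q else 0)).

End Total.

End Complexes.

(* Main.v *)
From HB Require Import structures.
From mathcomp Require Import all_boot all_order all_algebra.
From mathcomp Require Import zify.
From Stdlib Require Import ClassicalEpsilon.
Require Import Defs.
Set Implicit Arguments.
Unset Strict Implicit.
Unset Printing Implicit Defensive.
Import Order.TTheory GRing.Theory Num.Theory.
Local Open Scope ring_scope.
Local Open Scope cat_scope.

(** Homming out of a projective object [W] is exact and, as there are enough
    projectives, such [W] detect zero morphisms, inclusions of subobjects and
    isomorphisms.  So everything below is diagram chasing with morphisms
    [x : Mor W X], [W] projective, treated as elements of [X].

    Write [F^p] for the part of the total complex in the columns [>= p], and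
    [E] for [vert_coh C].  Extending the bounds [s n] past [n = a] in any
    strictly increasing way, the vanishing hypotheses imply that [E i j] is zero
    unless [s (i + j - 1) < i <= s (i + j)]: in total degree [n] the cohomology
    lives in the [n]-th block of columns [s (n - 1) < i <= s n].  In particular
    the sum [P n] is finite.

    Since [E i j] is projective, its identity lifts to a vertical cocycle [l]
    with values in [C i j].  The total differential of [l] starts in the next
    column, and its leading terms in the rest of the block are vertical
    cocycles of total degree [n + 1], hence vertical coboundaries: they can be
    corrected away ([remove_leading_terms]).  This gives [psi : P n -> S n] with
    leading terms [l] and with [d psi] in [F^(s n + 1)], the columns of the
    later blocks ([adapted_exists]).

    Assume [psi] and the differential of [P] are constructed in degrees
    [> n].  They compute the cohomology of [F^(s n + 1)] in degree [n + 1]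
    ([resolve_cocycle]), by comparing leading terms column by column
    ([approximate], [adapted_inj]).  Applied to the cocycle [d psi] defined on
    the projective [P n], this yields the differential [P n -> P (n + 1)] and a
    correction of [psi] in [F^(s n + 1)] that turns it into a chain map in
    degree [n].  The construction starts at [n > a], where [P n] is zero, and
    goes down ([resolution_exists]).

    The same comparison shows that [psi] is an isomorphism in degree [m] onto
    the cohomology of [F^p] for suitably small [p].  It remains to pass from
    [F^p] to the total complex.  Infinite direct sums need not be exact in [A],
    and this is where convergence of the spectral sequence enters.  The columns
    further left have no cohomology in the relevant degrees, so the images of
    the [H^m(F^p)] stabilise and their supremum is reached ([cocycle_push]);
    and an element of [F^p] that bounds in the total complex has, by the
    embedding of [E_oo] in the graded cohomology, a leading term that already
    bounds in [F^p] ([bounding_leading_term], [bounding_push]). *)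

(** * Preadditive categories and direct sums *)

Section PreadditiveLemmas.
Variable A : preadditive.
Implicit Types W X Y Z : A.

Lemma compNl X Y Z (g : Mor Y Z) (f : Mor X Y) : (- g) ∘ f = - (g ∘ f).
Proof. by apply: (addrI (g ∘ f)); rewrite -comp_addl !subrr comp0l. Qed.

Lemma compNr X Y Z (g : Mor Y Z) (f : Mor X Y) : g ∘ (- f) = - (g ∘ f).
Proof. by apply: (addrI (g ∘ f)); rewrite -comp_addr !subrr comp0r. Qed.

Lemma compBl X Y Z (g h : Mor Y Z) (f : Mor X Y) :
  (g - h) ∘ f = g ∘ f - h ∘ f.
Proof. by rewrite comp_addl compNl. Qed.

Lemma compBr X Y Z (g : Mor Y Z) (f h : Mor X Y) :
  g ∘ (f - h) = g ∘ f - g ∘ h.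
Proof. by rewrite comp_addr compNr. Qed.

Lemma from_zero X Y (f : Mor X Y) : is_zero X -> f = 0.
Proof. by move=> zX; case: (zX Y). Qed.

Lemma to_zero X Y (f : Mor Y X) : is_zero X -> f = 0.
Proof. by move=> zX; case: (zX Y). Qed.

Lemma is_zero_id X : id_mor X = 0 -> is_zero X.
Proof.
move=> id0 Y; split=> f; first by rewrite -(comp_idr f) id0 comp0r.
by rewrite -(comp_idl f) id0 comp0l.
Qed.

Lemma kernel_factor X Y (f : Mor X Y) K (k : Mor K X) W (g : Mor W X) :
  is_kernel f k -> f ∘ g = 0 -> exists h, k ∘ h = g.
Proof. by move=> [_ kP] /kP [h [hE _]]; exists h. Qed.

Lemma cokernel_factor X Y (f : Mor X Y) Q (q : Mor Y Q) W (g : Mor Y W) :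
  is_cokernel f q -> g ∘ f = 0 -> exists h, h ∘ q = g.
Proof. by move=> [_ qP] /qP [h [hE _]]; exists h. Qed.

Lemma is_cokernel_epi X Y (f : Mor X Y) Q (q : Mor Y Q) :
  is_cokernel f q -> is_epi q.
Proof.
move=> [qf0 qP] W g h gh.
have [|u [_ uU]] := qP W (g ∘ q); first by rewrite -comp_assoc qf0 comp0r.
by rewrite -(uU g erefl) -(uU h (esym gh)).
Qed.

(** The lifts of the individual summands have to be chosen simultaneously. *)
Lemma direct_sum_projective (I : Type) (X : I -> A) (D : direct_sum X) :
  (forall i, projective (X i)) -> projective D.
Proof.
move=> Xproj Y Z e epi_e f.
pose lift i := constructive_indefinite_description _
  (Xproj i _ _ _ epi_e (f ∘ ds_in D i)).
exists (ds_desc D (fun i => sval (lift i))).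
by apply: ds_ext => i; rewrite -comp_assoc (ds_descE D) (svalP (lift i)).
Qed.

Lemma direct_sum_zero (I : Type) (X : I -> A) (D : direct_sum X) :
  (forall i, is_zero (X i)) -> is_zero D.
Proof.
move=> X0; apply: is_zero_id; apply: ds_ext => i.
by rewrite comp0l; apply: from_zero (X0 i).
Qed.

End PreadditiveLemmas.

(** * Abelian categories, through points with values in projective objects *)

Section Abelian.
Variable A : abelian_category.
Implicit Types W X Y Z : A.

Lemma sub_mem_in X (S : subobject X) W (y : Mor W S) : sub_mem S (sub_in S ∘ y).
Proof. by exists y. Qed.

Lemma sub_mem0 X (S : subobject X) W : sub_mem S (0 : Mor W X).
Proof. by exists 0; rewrite comp0r. Qed.

Lemma sub_le_mem X (S S' : subobject X) W (x : Mor W X) :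
  sub_le S S' -> sub_mem S x -> sub_mem S' x.
Proof.
by move=> [u uE] [y <-]; exists (u ∘ y); rewrite comp_assoc uE.
Qed.

Lemma sub_mem_ker X Y (f : Mor X Y) W (x : Mor W X) :
  sub_mem (sub_ker f) x <-> f ∘ x = 0.
Proof.
split=> [[y <-]|fx0]; last exact: kernel_factor (kernelP f) fx0.
by rewrite comp_assoc (proj1 (kernelP f)) comp0l.
Qed.

(** A monomorphism is the kernel of its cokernel. *)
Lemma sub_mem_coker X (S : subobject X) W (x : Mor W X) :
  sub_mem S x <-> cokernel_pr (sub_in S) ∘ x = 0.
Proof.
split=> [[y <-]|qx0].
  by rewrite comp_assoc (proj1 (cokernelP (sub_in S))) comp0l.
have [Z [c cP]] := mono_normal (@sub_mono _ _ S).
have [c' c'E] := cokernel_factor (cokernelP (sub_in S)) (proj1 cP).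
by apply: (kernel_factor cP); rewrite -c'E -comp_assoc qx0 comp0r.
Qed.

Lemma sub_mem_inverse X Y (f : Mor X Y) (S : subobject Y) W (x : Mor W X) :
  sub_mem (sub_inverse f S) x <-> sub_mem S (f ∘ x).
Proof. by rewrite sub_mem_ker sub_mem_coker comp_assoc. Qed.

Lemma sub_mem_img_comp X Y (f : Mor X Y) W (x : Mor W X) :
  sub_mem (sub_img f) (f ∘ x).
Proof.
by apply/sub_mem_ker; rewrite comp_assoc (proj1 (cokernelP f)) comp0l.
Qed.

(** The cokernel of [sub_in S] kills [f], so it factors through the cokernel
    of [f], which kills the image. *)
Lemma sub_img_le X Y (f : Mor X Y) (S : subobject Y) :
  sub_mem S f -> sub_le (sub_img f) S.
Proof.
move=> Sf; apply/sub_mem_coker.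
have /sub_mem_coker Sf0 := Sf.
have [h <-] := cokernel_factor (cokernelP f) Sf0.
by rewrite -comp_assoc (proj1 (kernelP _)) comp0r.
Qed.

(** If [g] kills the corestriction of [f], then [f] factors through
    the subobject [ker g] of its image, which is then the whole image. *)
Lemma corestriction_epi X Y (f : Mor X Y) (e : Mor X (sub_img f)) :
  sub_in (sub_img f) ∘ e = f -> is_epi e.
Proof.
move=> fE; set m := sub_in (sub_img f).
suff kills0 Z (g : Mor (sub_img f) Z) : g ∘ e = 0 -> g = 0.
  move=> Z g h gh; apply/eqP; rewrite -subr_eq0; apply/eqP/kills0.
  by rewrite compBl gh subrr.
move=> ge0; have [e' e'E] := kernel_factor (kernelP g) ge0.
have mono_mk : is_mono (m ∘ kernel_in g).
  move=> W x y; rewrite -!comp_assoc => /(@sub_mono _ _ (sub_img f)).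
  exact: is_kernel_mono (kernelP g) W x y.
pose S := Subobject mono_mk.
have [l lE] : sub_le (sub_img f) S.
  by apply: sub_img_le; exists e'; rewrite /= -comp_assoc e'E.
have kl : kernel_in g ∘ l = id_mor _.
  by apply: (@sub_mono _ _ (sub_img f)); rewrite comp_assoc lE comp_idr.
by rewrite -(comp_idr g) -kl comp_assoc (proj1 (kernelP g)) comp0l.
Qed.

(** Homming out of a projective object is exact, so that images are
    computed on [W]-points. *)
Lemma sub_mem_img W (Wproj : projective W) X Y (f : Mor X Y) (y : Mor W Y) :
  sub_mem (sub_img f) y <-> exists x, f ∘ x = y.
Proof.
split=> [[z <-]|[x <-]]; last exact: sub_mem_img_comp.
have [|e eE] := iffRL (sub_mem_ker (cokernel_pr f) f).
  exact: (proj1 (cokernelP f)).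
have [x <-] := Wproj _ _ _ (corestriction_epi eE) z.
by exists x; rewrite comp_assoc eE.
Qed.

Lemma sub_mem_direct W (Wproj : projective W) X Y (f : Mor X Y)
    (S : subobject X) (y : Mor W Y) :
  sub_mem (sub_direct f S) y <-> exists x, sub_mem S x /\ f ∘ x = y.
Proof.
split=> [/(sub_mem_img Wproj)[x <-]|[_ [[x <-] <-]]].
  by exists (sub_in S ∘ x); rewrite comp_assoc; split=> //; apply: sub_mem_in.
by rewrite comp_assoc; apply: sub_mem_img_comp.
Qed.

Lemma sub_mem_meet W (Wproj : projective W) X (S S' : subobject X)
    (x : Mor W X) :
  sub_mem (sub_meet S S') x <-> sub_mem S x /\ sub_mem S' x.
Proof.
split=> [/(sub_mem_direct Wproj)[y [/sub_mem_inverse ? <-]]|].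
  by split=> //; apply: sub_mem_in.
move=> [[y yE] S'x]; apply/(sub_mem_direct Wproj); exists y; split=> //.
by apply/sub_mem_inverse; rewrite yE.
Qed.

Lemma quo_pr_eq0 X (S S' : subobject X) W (y : Mor W S) :
  quo_pr S S' ∘ y = 0 <-> sub_mem S' (sub_in S ∘ y).
Proof. by rewrite -sub_mem_coker sub_mem_inverse. Qed.

Lemma quo_pr_epi X (S S' : subobject X) : is_epi (quo_pr S S').
Proof. exact: is_cokernel_epi (cokernelP _). Qed.

(** A monomorphism that is also epi is the kernel of a zero morphism. *)
Lemma mono_epi_iso X Y (f : Mor X Y) : is_mono f -> is_epi f -> is_iso f.
Proof.
move=> mf ef; have [Z [c cP]] := mono_normal mf.
have c0 : c = 0 by apply: ef; rewrite comp0l; exact: (proj1 cP).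
have [g fg] : exists g, f ∘ g = id_mor Y.
  by apply: (kernel_factor cP); rewrite c0 comp0l.
by exists g; split=> //; apply: mf; rewrite comp_assoc fg comp_idl comp_idr.
Qed.

Hypothesis enoughP : enough_projectives A.

Lemma eq0_projective X Y (f : Mor X Y) :
  (forall W (x : Mor W X), projective W -> f ∘ x = 0) -> f = 0.
Proof.
move=> f0; have [W [e [Wproj epi_e]]] := enoughP X.
by apply: epi_e; rewrite comp0l; apply: f0.
Qed.

Lemma sub_le_projective X (S S' : subobject X) :
  (forall W (x : Mor W X), projective W -> sub_mem S x -> sub_mem S' x) ->
  sub_le S S'.
Proof.
move=> SS'; apply/sub_mem_coker; apply: eq0_projective => W x Wproj.
by rewrite -comp_assoc -sub_mem_coker; apply: SS' => //; apply: sub_mem_in.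
Qed.

Lemma iso_projective X Y (f : Mor X Y) :
  (forall W (x : Mor W X), projective W -> f ∘ x = 0 -> x = 0) ->
  (forall W (y : Mor W Y), projective W -> exists x, f ∘ x = y) -> is_iso f.
Proof.
move=> inj surj; apply: mono_epi_iso => [W g h fgh|Z g h gfh].
  apply/eqP; rewrite -subr_eq0; apply/eqP/eq0_projective => V x Vproj.
  by apply: inj => //; rewrite comp_assoc compBr fgh subrr comp0l.
apply/eqP; rewrite -subr_eq0; apply/eqP/eq0_projective => V y Vproj.
by have [x <-] := surj V y Vproj; rewrite comp_assoc compBl gfh subrr comp0l.
Qed.

(** * Cohomology and chain maps *)

Section Cohomology.
Implicit Types K L : complex A.

(** Gets rid of the transport in [cx_d_to].  The predicate [Q] varies with the
    degree, so that a condition on the preimage can be carried along. *)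
Lemma cx_d_to_mem K n W (Q : forall m, Mor W (K m) -> Prop)
    (x : Mor W (K (n + 1))) :
  (exists c, Q (n + 1 - 1) c /\ cx_d_to K (n + 1) ∘ c = x) <->
  (exists c, Q n c /\ cx_d K n ∘ c = x).
Proof.
rewrite /cx_d_to.
have shift m (e : m + 1 = n + 1) : m = n ->
    (exists c, Q m c /\ ecast k (Mor (K m) (K k)) e (cx_d K m) ∘ c = x) <->
    (exists c, Q n c /\ cx_d K n ∘ c = x).
  by move=> mn; subst m; rewrite (eq_irrelevance e erefl).
by apply: shift; rewrite addrK.
Qed.

Lemma boundary_mem K n W (Wproj : projective W) (x : Mor W (K (n + 1))) :
  sub_mem (boundaries K (n + 1)) x <-> exists y, cx_d K n ∘ y = x.
Proof.
rewrite (sub_mem_img Wproj); have := cx_d_to_mem (fun _ _ => True) x.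
move=> [to_d from_d]; split=> [[y yE]|[y yE]].
  by have [|c [_ <-]] := to_d; [exists y | exists c].
by have [|c [_ <-]] := from_d; [exists y | exists c].
Qed.

Lemma cycles_d K n : cx_d K n ∘ sub_in (cycles K n) = 0.
Proof. exact: (proj1 (kernelP _)). Qed.

Lemma cycles_lift K n W (x : Mor W (K n)) :
  cx_d K n ∘ x = 0 -> exists x', sub_in (cycles K n) ∘ x' = x.
Proof. exact: kernel_factor (kernelP _). Qed.

Lemma coh_class_eq0 K n W (x : Mor W (cycles K n)) :
  coh_class K n ∘ x = 0 <-> sub_mem (boundaries K n) (sub_in (cycles K n) ∘ x).
Proof. exact: quo_pr_eq0. Qed.

Lemma coh_class_lift K n W (Wproj : projective W) (h : Mor W (cohomology K n)) :
  exists x, coh_class K n ∘ x = h.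
Proof. exact: Wproj (@quo_pr_epi _ _ _) h. Qed.

Lemma exact_lift K n W (Wproj : projective W) (x : Mor W (K (n + 1))) :
  is_zero (cohomology K (n + 1)) -> cx_d K (n + 1) ∘ x = 0 ->
  exists y, cx_d K n ∘ y = x.
Proof.
move=> H0 /cycles_lift [x' <-]; apply/(boundary_mem Wproj)/coh_class_eq0.
exact: to_zero H0.
Qed.

(** A section of the projection from cycles to cohomology, viewed as a map
    to the complex. *)
Definition represents K n (l : Mor (cohomology K n) (K n)) :=
  exists l', sub_in (cycles K n) ∘ l' = l /\ coh_class K n ∘ l' = id_mor _.

Lemma represents_exists K n :
  projective (cohomology K n) -> exists l, represents (K := K) (n := n) l.
Proof.
move=> Hproj; have [l' l'E] := coh_class_lift Hproj (id_mor _).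
by exists (sub_in (cycles K n) ∘ l'), l'.
Qed.

Lemma represents_d K n (l : Mor (cohomology K n) (K n)) :
  represents l -> cx_d K n ∘ l = 0.
Proof. by move=> [l' [<- _]]; rewrite comp_assoc cycles_d comp0l. Qed.

(** Together with [represents_inj]: with the representing map [l], the
    projective cohomology object becomes a model of the cohomology. *)
Lemma represents_surj K n (l : Mor (cohomology K (n + 1)) (K (n + 1))) W
    (x : Mor W (K (n + 1))) :
  projective W -> represents l -> cx_d K (n + 1) ∘ x = 0 ->
  exists z y, x - l ∘ z = cx_d K n ∘ y.
Proof.
move=> Wproj [l' [<- l'E]] /cycles_lift [x' <-].
exists (coh_class K (n + 1) ∘ x').
suff /(boundary_mem Wproj)[y yE] : sub_mem (boundaries K (n + 1))
    (sub_in (cycles K (n + 1)) ∘ (x' - l' ∘ (coh_class K (n + 1) ∘ x'))).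
  by exists y; rewrite yE compBr !comp_assoc.
rewrite -coh_class_eq0; set k := coh_class K (n + 1) in l'E *.
by rewrite compBr (comp_assoc k l') l'E comp_idl subrr.
Qed.

Lemma represents_inj K n (l : Mor (cohomology K (n + 1)) (K (n + 1))) W
    (z : Mor W (cohomology K (n + 1))) y :
  projective W -> represents l -> l ∘ z = cx_d K n ∘ y -> z = 0.
Proof.
move=> Wproj [l' [<- l'E]] lz; rewrite -(comp_idl z) -l'E -comp_assoc.
by apply/coh_class_eq0/(boundary_mem Wproj); exists y; rewrite comp_assoc.
Qed.

(** Points of the cohomology with values in a projective object lift to
    cycles, and two such lifts differ by a coboundary. *)
Lemma induced_iso_projective K L (f : chain_map K L) n :
  (forall W (x : Mor W (L (n + 1))), projective W -> cx_d L (n + 1) ∘ x = 0 ->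
     exists (z : Mor W (K (n + 1))) (y : Mor W (L n)),
       cx_d K (n + 1) ∘ z = 0 /\ x - f (n + 1) ∘ z = cx_d L n ∘ y) ->
  (forall W (z : Mor W (K (n + 1))) (y : Mor W (L n)), projective W ->
     cx_d K (n + 1) ∘ z = 0 -> f (n + 1) ∘ z = cx_d L n ∘ y ->
     exists t, z = cx_d K n ∘ t) ->
  exists phi : Mor (cohomology K (n + 1)) (cohomology L (n + 1)),
    induced_in_cohomology f phi /\ is_iso phi.
Proof.
move=> surj inj.
have [|z zE] := @cycles_lift L (n + 1) _ (f (n + 1) ∘ sub_in (cycles K (n + 1))).
  by rewrite comp_assoc -cmapE -comp_assoc cycles_d comp0r.
have [|phi phiE] := cokernel_factor (cokernelP
    (sub_in (sub_inverse (sub_in (cycles K (n + 1))) (boundaries K (n + 1)))))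
    (g := coh_class L (n + 1) ∘ z).
  apply: eq0_projective => W x Wproj; rewrite -!comp_assoc.
  apply/coh_class_eq0/(boundary_mem Wproj).
  set i := sub_in (sub_inverse _ _).
  have : sub_mem (boundaries K (n + 1)) (sub_in (cycles K (n + 1)) ∘ (i ∘ x)).
    by apply/sub_mem_inverse/sub_mem_in.
  case/(boundary_mem Wproj) => y yE; exists (f n ∘ y).
  by rewrite !comp_assoc zE -cmapE -!comp_assoc yE.
exists phi; split; first by exists z.
have {}phiE : phi ∘ coh_class K (n + 1) = coh_class L (n + 1) ∘ z by [].
apply: iso_projective => W x Wproj.
  have [x' <-] := coh_class_lift Wproj x.
  rewrite comp_assoc phiE -comp_assoc => /coh_class_eq0 /(boundary_mem Wproj)[y].
  rewrite comp_assoc zE -comp_assoc => /esym yE.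
  apply/coh_class_eq0/(boundary_mem Wproj).
  have [|t ->] := inj W _ y Wproj _ yE; last by exists t.
  by rewrite comp_assoc cycles_d comp0l.
have [x' <-] := coh_class_lift Wproj x.
have [|w [y [dw wE]]] := surj W (sub_in (cycles L (n + 1)) ∘ x') Wproj.
  by rewrite comp_assoc cycles_d comp0l.
have [w' w'E] := cycles_lift dw; exists (coh_class K (n + 1) ∘ w').
rewrite comp_assoc phiE -comp_assoc; apply/esym/eqP; rewrite -subr_eq0 -compBr.
apply/eqP/coh_class_eq0/(boundary_mem Wproj); exists y; rewrite -wE compBr.
by rewrite (comp_assoc _ z) zE -w'E comp_assoc.
Qed.

End Cohomology.
End Abelian.

(** * Direct sums along a diagonal *)

Lemma dcol_inj n : injective (@dcol n).
Proof.
move=> [i j ij] [i' j' ij'] /= ii'; subst i'.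
have jj' : j = j' by apply: (addrI i); rewrite ij ij'.
by subst j'; rewrite (eq_irrelevance ij ij').
Qed.

HB.instance Definition _ n := Equality.copy (diag n) (inj_type (@dcol_inj n)).

Definition diag_at (n p : int) : diag n := Diag (etrans (addrC p (n - p)) (subrK p n)).

Section Kronecker.
Variables (A : preadditive) (n : int) (X : diag n -> A).

(** The summands [X q] and [X r] are different types even when [q] and [r] are
    equal, whence the transport. *)
Definition kronecker (q r : diag n) : Mor (X q) (X r) :=
  if q =P r is ReflectT e then ecast t (Mor (X q) (X t)) e (id_mor (X q)) else 0.

Lemma kronecker_id q : kronecker q q = id_mor (X q).
Proof. by rewrite /kronecker; case: eqP => // e; rewrite (eq_irrelevance e erefl). Qed.

Lemma kronecker_neq q r : q <> r -> kronecker q r = 0.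
Proof. by rewrite /kronecker; case: eqP. Qed.

End Kronecker.

(** Summands are adjoined column by column; the intermediate object is the sum
    of the summands in the first [k] columns, with zero as the injection of
    every other summand, so that the family itself need not be changed. *)
Lemma direct_sum_finite (A : abelian_category) n (X : diag n -> A) (lo : int) (k : nat) :
  (forall q, ~~ (lo <= dcol q < lo + k%:Z) -> is_zero (X q)) ->
  inhabited (direct_sum X).
Proof.
move=> X0; pose c (k : nat) (q : diag n) := lo <= dcol q < lo + k%:Z.
suff [B [inB [desc [descE ext]]]] : exists (B : A)
    (inB : forall q, Mor (X q) B) (desc : forall W, (forall q, Mor (X q) W) -> Mor B W),
    (forall W (f : forall q, Mor (X q) W) q,
       desc W f ∘ inB q = if c k q then f q else 0) /\
    (forall W (g h : Mor B W),
       (forall q, c k q -> g ∘ inB q = h ∘ inB q) -> g = h).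
  exists; apply: (@DirectSum _ _ _ B inB desc) => [W f q|W g h gh].
    by rewrite descE; case: ifP => // /negbT /X0 q0; rewrite (from_zero (f q) q0).
  by apply: ext.
elim: k {X0} => [|k [B [inB [desc [descE ext]]]]].
  have [Z Z0] := ab_zero A.
  exists Z, (fun _ => 0), (fun _ _ => 0); split=> [W f q|W g h _].
    by rewrite comp0r ifF // /c; lia.
  by rewrite (from_zero g Z0) (from_zero h Z0).
pose q0 := diag_at n (lo + k%:Z).
have cS q : c k.+1 q = (q == q0) || c k q.
  by rewrite -(inj_eq (@dcol_inj n)) /c /=; lia.
have cq0 : c k q0 = false by rewrite /c /=; lia.
have [S [i1 [i2 [p1 [p2 [p1i1 p2i2 p1i2 p2i1 ip]]]]]] := ab_biprod B (X q0).
exists S, (fun q => i1 ∘ inB q + i2 ∘ kronecker X q q0).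
exists (fun W f => desc W f ∘ p1 + f q0 ∘ p2); split=> [W f q|W g h gh].
  rewrite comp_addr !comp_addl -!comp_assoc.
  rewrite (comp_assoc p1) (comp_assoc p1 i2) (comp_assoc p2) (comp_assoc p2 i2).
  rewrite p1i1 p2i2 p1i2 p2i1 !comp0l !comp0r !comp_idl addr0 add0r descE cS.
  case: eqP => [->|neq] /=; first by rewrite cq0 kronecker_id comp_idr add0r.
  by rewrite kronecker_neq // comp0r addr0.
have inB0 : inB q0 = 0.
  have := descE _ inB q0; rewrite cq0 => inB0.
  rewrite -(comp_idl (inB q0)) -inB0; congr (_ ∘ _); apply: ext => q cq.
  by rewrite descE cq comp_idl.
rewrite -(comp_idr g) -(comp_idr h) -ip !comp_addr !comp_assoc.
congr (_ ∘ p1 + _ ∘ p2).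
  apply: ext => q cq; have := gh q; rewrite cS cq orbT => /(_ isT).
  rewrite kronecker_neq => [|qq0]; last by move: cq; rewrite qq0 cq0.
  by rewrite comp0r addr0 !comp_assoc.
have := gh q0; rewrite cS eqxx => /(_ isT).
by rewrite inB0 kronecker_id comp0r add0r comp_idr.
Qed.

Section DiagonalSums.
Variables (A : preadditive) (X : int -> int -> A).
Variable D : forall n : int, direct_sum (fun q : diag n => X (dcol q) (drow q)).
Implicit Types W : A.

Definition component n (q : diag n) : Mor (D n) (X (dcol q) (drow q)) :=
  ds_desc (D n) (fun r => kronecker (fun q => X (dcol q) (drow q)) r q).

Lemma component_in n (q : diag n) : component q ∘ ds_in (D n) q = id_mor _.
Proof. by rewrite (ds_descE (D n)) kronecker_id. Qed.

Lemma component_in_neq n (q r : diag n) :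
  dcol q <> dcol r -> component q ∘ ds_in (D n) r = 0.
Proof.
by move=> qr; rewrite (ds_descE (D n)) kronecker_neq // => rq; rewrite rq in qr.
Qed.

Definition truncation (p n : int) : Mor (D n) (D n) :=
  ds_desc (D n) (fun q => if p <= dcol q then ds_in (D n) q else 0).

Lemma truncation_in p n (q : diag n) :
  truncation p n ∘ ds_in (D n) q = if p <= dcol q then ds_in (D n) q else 0.
Proof. exact: (ds_descE (D n)). Qed.

(** [x] is a point of the sum of the summands in the columns [>= p].  An
    equation with an idempotent is easier to rewrite with than a factorisation
    through a subobject. *)
Definition inF (p n : int) W (x : Mor W (D n)) := truncation p n ∘ x = x.

Lemma inF_comp p n W V (x : Mor W (D n)) (w : Mor V W) :
  inF p x -> inF p (x ∘ w).
Proof. by rewrite /inF comp_assoc => ->. Qed.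

Lemma inF0 p n W : inF p (0 : Mor W (D n)).
Proof. exact: comp0r. Qed.

Lemma inFB p n W (x y : Mor W (D n)) : inF p x -> inF p y -> inF p (x - y).
Proof. by rewrite /inF compBr => -> ->. Qed.

Lemma inFD p n W (x y : Mor W (D n)) : inF p x -> inF p y -> inF p (x + y).
Proof. by rewrite /inF comp_addr => -> ->. Qed.

Lemma inF_in p n (q : diag n) W (x : Mor W (X (dcol q) (drow q))) :
  p <= dcol q -> inF p (ds_in (D n) q ∘ x).
Proof. by move=> pq; apply: inF_comp; rewrite /inF truncation_in pq. Qed.

Lemma inF_truncation p p' n : p <= p' -> inF p (truncation p' n).
Proof.
move=> pp'; apply: ds_ext => q; rewrite -comp_assoc truncation_in.
case: ifP => [p'q|_]; last by rewrite comp0r.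
by rewrite truncation_in (le_trans pp' p'q).
Qed.

Lemma inF_le p p' n W (x : Mor W (D n)) : p <= p' -> inF p' x -> inF p x.
Proof. by move=> pp' <-; apply/inF_comp/inF_truncation. Qed.

Lemma inF_all p n W (x : Mor W (D n)) :
  (forall q : diag n, dcol q < p -> is_zero (X (dcol q) (drow q))) -> inF p x.
Proof.
move=> X0; rewrite /inF -[RHS]comp_idl; congr (_ ∘ x); apply: ds_ext => q.
rewrite truncation_in comp_idl; case: leP => // /X0 q0.
exact/esym/from_zero.
Qed.

Lemma inF_eq0 p n W (x : Mor W (D n)) :
  (forall q : diag n, p <= dcol q -> is_zero (X (dcol q) (drow q))) ->
  inF p x -> x = 0.
Proof.
move=> X0 <-; rewrite -(comp0l _ x); congr (_ ∘ x); apply: ds_ext => q.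
rewrite truncation_in comp0l; case: leP => // /X0 q0.
exact/from_zero.
Qed.

Lemma component_inF p n (q : diag n) W (x : Mor W (D n)) :
  dcol q < p -> inF p x -> component q ∘ x = 0.
Proof.
move=> qp <-; rewrite comp_assoc -(comp0l _ x); congr (_ ∘ x).
apply: ds_ext => r; rewrite -comp_assoc truncation_in comp0l.
case: leP => [pr|_]; last exact: comp0r.
by apply: component_in_neq; lia.
Qed.

(** Splits off the leading term; this stands in for the decomposition of a
    point into its components, of which there could be infinitely many. *)
Lemma inF_split n (q : diag n) W (x : Mor W (D n)) :
  inF (dcol q) x ->
  x = truncation (dcol q + 1) n ∘ x + ds_in (D n) q ∘ (component q ∘ x).
Proof.
move=> xF; rewrite -{1}xF !comp_assoc -comp_addl; congr (_ ∘ x).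
apply: ds_ext => r; rewrite comp_addl -comp_assoc !truncation_in.
have [->|/eqP rq] := eqVneq r q.
  by rewrite lexx component_in comp_idr ifF ?add0r //; lia.
have {}rq : dcol q <> dcol r by move=> /dcol_inj qr; apply: rq.
rewrite component_in_neq // comp0r addr0.
by congr (if _ then _ else _); lia.
Qed.

Lemma inF_succ n (q : diag n) W (x : Mor W (D n)) :
  inF (dcol q) x -> component q ∘ x = 0 -> inF (dcol q + 1) x.
Proof.
move=> xF x0; rewrite (inF_split xF) x0 comp0r addr0; exact/inF_comp/inF_truncation.
Qed.

End DiagonalSums.
Arguments inF {A X} D p {n W} x.

Lemma filtered_map (A : preadditive) (X Y : int -> int -> A)
    (D : forall n : int, direct_sum (fun q : diag n => X (dcol q) (drow q)))
    (E : forall n : int, direct_sum (fun q : diag n => Y (dcol q) (drow q)))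
    m n (f : Mor (D m) (E n)) p W (x : Mor W (D m)) :
  (forall q : diag m, p <= dcol q -> inF E p (f ∘ ds_in (D m) q)) ->
  inF D p x -> inF E p (f ∘ x).
Proof.
move=> fF <-; rewrite comp_assoc; apply: inF_comp.
apply: ds_ext => q; rewrite -!comp_assoc truncation_in.
by case: ifP => [/fF|_]; rewrite ?comp0r.
Qed.

(** * Leading terms in the total complex *)

Section TotalComplex.
Variables (A : abelian_category) (C : bicomplex A).
Variable S : forall n : int, direct_sum (fun q : diag n => C (dcol q) (drow q)).
Implicit Types W : A.

Local Notation d n := (tot_d S n).

Lemma tot_d_in n (q : diag n) :
  d n ∘ ds_in (S n) q =
    ds_in (S (n + 1)) (diag_h q) ∘ bi_h C (dcol q) (drow q) +
    ds_in (S (n + 1)) (diag_v q) ∘ bi_v C (dcol q) (drow q).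
Proof. exact: (ds_descE (S n)). Qed.

Lemma tot_dd0 n W (x : Mor W (S n)) : d (n + 1) ∘ (d n ∘ x) = 0.
Proof. by rewrite comp_assoc tot_dd comp0l. Qed.

Lemma inF_d p n W (x : Mor W (S n)) : inF S p x -> inF S p (d n ∘ x).
Proof.
apply: filtered_map => q pq; rewrite tot_d_in.
by apply: inFD; apply: inF_in => //=; lia.
Qed.

Lemma component_d_in n (q : diag n) W (y : Mor W (C (dcol q) (drow q))) :
  component S (diag_v q) ∘ (d n ∘ (ds_in (S n) q ∘ y)) =
    bi_v C (dcol q) (drow q) ∘ y.
Proof.
rewrite (comp_assoc (d n)) tot_d_in comp_addl comp_addr !comp_assoc.
rewrite component_in_neq; last by rewrite /=; lia.
by rewrite !comp0l add0r component_in comp_idl.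
Qed.

(** On the associated graded object of the column filtration, [d] is [d_v]. *)
Lemma component_d n (q : diag n) W (x : Mor W (S n)) :
  inF S (dcol q) x ->
  component S (diag_v q) ∘ (d n ∘ x) =
    bi_v C (dcol q) (drow q) ∘ (component S q ∘ x).
Proof.
move=> /inF_split {1}->; rewrite !comp_addr component_d_in.
rewrite (@component_inF _ _ _ (dcol q + 1)) ?add0r //=; first by lia.
exact/inF_d/inF_comp/inF_truncation.
Qed.

(** The truncation is idempotent, so its image consists of its fixed points. *)
Lemma sub_mem_column_filtration p n W (x : Mor W (S n)) :
  sub_mem (column_filtration S p n) x <-> inF S p x.
Proof.
split=> [/sub_mem_ker|<-]; last exact: sub_mem_img_comp.
move=> qx; have [|h hE] := cokernel_factor (g := id_mor _ - truncation S p n)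
    (cokernelP (truncation S p n)).
  by rewrite compBl comp_idl inF_truncation // subrr.
apply/eqP; rewrite eq_sym -subr_eq0; apply/eqP.
rewrite -[X in X - _]comp_idl -compBl -hE -comp_assoc.
by rewrite [X in h ∘ X]qx comp0r.
Qed.

(** A leading term that is a vertical cocycle is a vertical coboundary where
    the column is exact, and can then be removed by a coboundary of the total
    complex. *)
Lemma remove_leading_term n (q : diag n) W (x : Mor W (S (n + 1))) :
  projective W -> is_zero (vert_coh C (dcol q) (drow q + 1)) ->
  inF S (dcol q) x -> inF S (dcol q + 1) (d (n + 1) ∘ x) ->
  exists y, inF S (dcol q) y /\ inF S (dcol q + 1) (x - d n ∘ y).
Proof.
move=> Wproj E0 xF dxF.
have vx0 : bi_v C (dcol q) (drow q + 1) ∘ (component S (diag_v q) ∘ x) = 0.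
  rewrite -(component_d (q := diag_v q)) //.
  by apply: (component_inF (q := diag_v (diag_v q)) _ dxF); rewrite /=; lia.
have [y yE] := exact_lift (K := column C (dcol q)) Wproj E0 vx0.
have yF : inF S (dcol q) (ds_in (S n) q ∘ y) by apply: inF_in.
exists (ds_in (S n) q ∘ y); split=> //.
apply: (inF_succ (q := diag_v q)); first by apply: inFB => //; apply: inF_d.
by rewrite compBr component_d_in -yE subrr.
Qed.

(** Only the differential of [x] modulo [F^p'] matters: the corrections do not
    change it, and the leading terms met on the way lie in columns [< p']. *)
Lemma remove_leading_terms (n p p' : int) W (x : Mor W (S (n + 1))) :
  projective W -> p <= p' ->
  (forall i j : int, i + j = n + 1 -> p <= i -> i < p' -> is_zero (vert_coh C i j)) ->
  inF S p x -> inF S p' (d (n + 1) ∘ x) ->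
  exists y, inF S p y /\ inF S p' (x - d n ∘ y).
Proof.
move=> Wproj pp'; have [k p'E] : exists k : nat, p' = p + k%:Z.
  by exists (absz (p' - p)%R); lia.
rewrite {p' pp'}p'E; elim: k p x => [|k IH] p x E0 xF dxF.
  exists 0; split; rewrite ?comp0r ?subr0; first exact: inF0.
  by apply: (inF_le _ xF); lia.
have [] := @remove_leading_term n (diag_at n p) W x Wproj _ xF.
- by apply: E0; rewrite /=; lia.
- by apply: (inF_le _ dxF); rewrite /=; lia.
move=> y [/= yF xyF].
have [||z [zF xyzF]] := IH (p + 1) (x - d n ∘ y) _ xyF.
- by move=> i j ij p1i ik; apply: E0; lia.
- by rewrite compBr tot_dd0 subr0; apply: (inF_le _ dxF); lia.
exists (y + z); split; first by apply: inFD => //; apply: (inF_le _ zF); lia.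
by rewrite comp_addr opprD addrA; apply: (inF_le _ xyzF); lia.
Qed.

End TotalComplex.

(** * Consequences of convergence *)

Section Convergence.
Variables (A : abelian_category) (enoughP : enough_projectives A).
Variables (C : bicomplex A) (Cup : upper_half_plane C).
Variable S : forall n : int, direct_sum (fun q : diag n => C (dcol q) (drow q)).
Implicit Types W : A.

Local Notation d n := (tot_d S n).
Local Notation K := (total_complex S).
Local Notation fil := (@column_filtration A C S).

(** In the upper half-plane, the columns [> n] do not meet the diagonal [n]. *)
Lemma inF_upper p n W (x : Mor W (S n)) : n < p -> inF S p x -> x = 0.
Proof. by move=> np; apply: inF_eq0 => -[i j ij] /= pi; apply: Cup; lia. Qed.

Lemma coh_fil_class p n W (x : Mor W (S n)) (x' : Mor W (cycles K n)) :
  inF S p x -> sub_in (cycles K n) ∘ x' = x ->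
  sub_mem (coh_fil fil p n) (coh_class K n ∘ x').
Proof.
move=> xF x'E; have [|u uE] := iffRL
    (sub_mem_inverse (sub_in (cycles K n)) (fil p n) x').
  by rewrite x'E; apply/sub_mem_column_filtration.
by rewrite /coh_fil /sub_direct -uE comp_assoc; apply: sub_mem_img_comp.
Qed.

(** Since the columns to the left of [p] carry no cohomology of degree
    [n + 1], the classes supported there can be pushed into [F^p]. *)
Lemma coh_fil_stable (p p' n : int) :
  (forall i j : int, i + j = n + 1 -> i < p -> is_zero (vert_coh C i j)) ->
  sub_le (coh_fil fil p' (n + 1)) (coh_fil fil p (n + 1)).
Proof.
move=> E0; apply: sub_le_projective => // W h Wproj.
case/(sub_mem_direct Wproj) => x [/sub_mem_inverse /sub_mem_column_filtration xF <-].
have dx : d (n + 1) ∘ (sub_in (cycles K (n + 1)) ∘ x) = 0.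
  by rewrite comp_assoc [X in X ∘ x](cycles_d K) comp0l.
have [y [_ xyF]] : exists y, inF S p' y /\
    inF S p (sub_in (cycles K (n + 1)) ∘ x - d n ∘ y).
  have [pp'|p'p] := leP p p'.
    exists 0; split; rewrite ?comp0r ?subr0; first exact: inF0.
    exact: inF_le xF.
  apply: (remove_leading_terms Wproj (ltW p'p)) => //.
    by move=> i j ij _; apply: E0.
  by rewrite dx; apply: inF0.
have [|x' x'E] := @cycles_lift _ K (n + 1) W
    (sub_in (cycles K (n + 1)) ∘ x - d n ∘ y).
  by rewrite [cx_d K _ ∘ _]compBr [X in X - _]dx [X in _ - X]tot_dd0 subr0.
have <- : coh_class K (n + 1) ∘ x' = coh_class K (n + 1) ∘ x.
  apply/eqP; rewrite eq_sym -subr_eq0 -compBr; apply/eqP/coh_class_eq0.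
  apply/(boundary_mem Wproj); exists y.
  by rewrite compBr x'E subKr.
exact: coh_fil_class xyF x'E.
Qed.

(** By convergence the classes supported in some [F^p'] exhaust the cohomology
    of the total complex; being stable, they are those supported in [F^p]. *)
Lemma cocycle_push (p n : int) W (x : Mor W (S (n + 1))) :
  ss_converges fil ->
  (forall i j : int, i + j = n + 1 -> i < p -> is_zero (vert_coh C i j)) ->
  projective W -> d (n + 1) ∘ x = 0 ->
  exists x' y, [/\ inF S p x', d (n + 1) ∘ x' = 0 & x - x' = d n ∘ y].
Proof.
move=> [_ /(_ (n + 1)) [_ top_le] _] E0 Wproj dx.
have [x1 x1E] := cycles_lift (K := K) dx.
have : sub_mem (coh_fil fil p (n + 1)) (coh_class K (n + 1) ∘ x1).
  apply: (sub_le_mem (top_le _ _)) => [p'|]; first exact: coh_fil_stable.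
  by rewrite -[_ ∘ x1]comp_idl; apply: sub_mem_img_comp.
case/(sub_mem_direct Wproj) => x2 [/sub_mem_inverse /sub_mem_column_filtration x2F].
move=> x12; exists (sub_in (cycles K (n + 1)) ∘ x2).
have [|y yE] := iffLR (boundary_mem (K := K) (n := n) Wproj
    (x - sub_in (cycles K (n + 1)) ∘ x2)).
  by rewrite -x1E -compBr -coh_class_eq0 compBr x12 subrr.
exists y; split=> //.
by rewrite comp_assoc [X in X ∘ x2](cycles_d K) comp0l.
Qed.

(** Let [E_oo] at [(p', n + 1 - p')] be [Zoo / Boo].  A cocycle [x] of
    [F^p'] that bounds in the total complex has class [0] in the cohomology of
    the total complex, hence in its graded piece, so that the leading term of
    [x] lies in [Boo] because [E_oo] embeds in that graded piece.  As the
    columns to the left of [p] carry no cohomology of degree [n], each [B_r]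
    consists of leading terms of coboundaries of elements of [F^p], and so
    does their supremum [Boo]. *)
Lemma bounding_leading_term (p p' n : int) W (x : Mor W (S (n + 1))) y :
  ss_weakly_converges fil ->
  (forall i j : int, i + j = n -> i < p -> is_zero (vert_coh C i j)) ->
  projective W -> p <= p' -> inF S p' x -> x = d n ∘ y ->
  exists c, inF S p c /\ inF S (p' + 1) (x - d n ∘ c).
Proof.
move=> conv E0 Wproj pp' xF xE.
have [Zoo [Boo [[_ Zinf] [_ Bsup] [phi [[psi [psi_phi _]] phiE]]]]] := conv p' (n + 1).
(* [B_r] is built from coboundaries of elements of [F^(p' - r + 1)], which is
   [F^p] for this [r]. *)
pose r := absz (p' - p + 1)%R.
have rE : p' - r%:Z + 1 = p by rewrite /r; lia.
have BP V (b : Mor V _) : projective V -> forall k : nat,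
    sub_mem (ss_B fil p' (n + 1) k) b <-> exists e c,
      [/\ inF S p' e, mod_pr fil p' (n + 1) ∘ e = b,
          inF S (p' - k%:Z + 1) c & d n ∘ c = e].
  move=> Vproj k; rewrite (sub_mem_direct Vproj); split.
    case=> e [/(sub_mem_meet Vproj) [/sub_mem_column_filtration eF]].
    case/(sub_mem_direct Vproj)/(cx_d_to_mem (K := K)
      (fun m c => sub_mem (fil (p' - k%:Z + 1) m) c)) => c.
    by case=> /sub_mem_column_filtration cF cE eE; exists e, c.
  case=> e [c [eF eE cF cE]]; exists e; split=> //; apply/(sub_mem_meet Vproj).
  split; first exact/sub_mem_column_filtration.
  apply/(sub_mem_direct Vproj)/(cx_d_to_mem (K := K)
      (fun m c => sub_mem (fil (p' - k%:Z + 1) m) c)).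
  by exists c; split=> //; apply/sub_mem_column_filtration.
have B_stable k : sub_le (ss_B fil p' (n + 1) k) (ss_B fil p' (n + 1) r).
  apply: sub_le_projective => // V b Vproj /(BP _ _ Vproj) [e [c [eF eE cF cE]]].
  apply/(BP _ _ Vproj); rewrite rE.
  have [pk|kp] := leP p (p' - k%:Z + 1).
    by exists e, c; split=> //; apply: inF_le cF.
  have [n' nE] : exists n', n = n' + 1 by exists (n - 1); rewrite subrK.
  subst n; have [||t [_ ctF]] := remove_leading_terms Vproj (ltW kp) _ cF.
  - by move=> i j ij _; apply: E0.
  - by rewrite cE; apply: inF_le eF.
  by exists e, (c - d n' ∘ t); rewrite compBr tot_dd0 subr0; split.
have dx : d (n + 1) ∘ x = 0 by rewrite xE tot_dd0.
have [x1 x1E] := cycles_lift (K := K) dx.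
have : sub_mem Zoo (mod_pr fil p' (n + 1) ∘ x).
  have : sub_le (sub_img (mod_pr fil p' (n + 1) ∘ x)) Zoo.
    apply: Zinf => k; apply: sub_img_le; apply/(sub_mem_direct Wproj).
    exists x; split=> //; apply/(sub_mem_meet Wproj).
    split; first exact/sub_mem_column_filtration.
    by apply/sub_mem_inverse; rewrite [_ ∘ x]dx; apply: sub_mem0.
  move/sub_le_mem; apply; rewrite -[X in sub_mem _ X]comp_idr.
  exact: sub_mem_img_comp.
case=> z zE.
(* Zero represents the class of [x] in the graded piece. *)
have class0 : coh_class K (n + 1) ∘ x1 = 0.
  by apply/coh_class_eq0/(boundary_mem Wproj); rewrite x1E; exists y.
have phiz : phi ∘ (quo_pr Zoo Boo ∘ z) = 0.
  rewrite (phiE W x1 z 0) ?comp0r ?class0 //; last by rewrite x1E.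
  by rewrite x1E; apply/sub_mem_column_filtration.
have : quo_pr Zoo Boo ∘ z = 0.
  by rewrite -[LHS]comp_idl -psi_phi -comp_assoc phiz comp0r.
move/quo_pr_eq0/(sub_le_mem (Bsup _ B_stable)); rewrite zE.
case/(BP _ _ Wproj) => e [c [eF eE cF cE]]; rewrite rE in cF.
exists c; split=> //; apply/sub_mem_column_filtration/sub_mem_coker.
by rewrite cE compBr [X in X - _](esym eE) subrr.
Qed.

(** Leading terms are removed one by one; this ends because no column
    [> n + 1] meets the diagonal [n + 1]. *)
Lemma bounding_push (p n : int) W (x : Mor W (S (n + 1))) y :
  ss_weakly_converges fil ->
  (forall i j : int, i + j = n -> i < p -> is_zero (vert_coh C i j)) ->
  projective W -> inF S p x -> x = d n ∘ y ->
  exists c, inF S p c /\ x = d n ∘ c.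
Proof.
move=> conv E0 Wproj.
suff peel (k : nat) (p' : int) (u : Mor W (S (n + 1))) v : p <= p' -> n + 1 < p' + k%:Z ->
    inF S p' u -> u = d n ∘ v -> exists c, inF S p c /\ u = d n ∘ c.
  by move=> xF xE; apply: (peel (absz (n + 2 - p)%R) p x y _ _ xF xE); lia.
elim: k p' u v => [|k IH] p' u v pp' kn uF uE.
  exists 0; rewrite comp0r; split; first exact: inF0.
  by apply: inF_upper uF; lia.
have [c [cF ucF]] := bounding_leading_term conv E0 Wproj pp' uF uE.
have [|||c' [c'F uc]] := IH (p' + 1) (u - d n ∘ c) (v - c) _ _ ucF.
- by lia.
- by lia.
- by rewrite compBr uE.
exists (c' + c); split; first exact: inFD.
by rewrite comp_addr -uc subrK.
Qed.

End Convergence.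

(** The value at [n] is chosen as a function of the value at [n + 1].  A fixed
    choice function [extend], defined also on values that are not good, makes
    the approximations of increasing depth agree, so that they define [t]. *)
Lemma backward_choice (T : int -> Type) (good : forall n, T n -> Prop)
    (link : forall n, T n -> T (n + 1) -> Prop) (N : int) (t0 : forall n, T n) :
  (forall n, N <= n -> good n (t0 n) /\ link n (t0 n) (t0 (n + 1))) ->
  (forall n (t : T (n + 1)), good (n + 1) t -> exists t', good n t' /\ link n t' t) ->
  exists t : forall n, T n, forall n, good n (t n) /\ link n (t n) (t (n + 1)).
Proof.
move=> t0P step.
have extend n (t : T (n + 1)) :
    {t' : T n | good (n + 1) t -> good n t' /\ link n t' t}.
  apply: constructive_indefinite_description.
  have [/step [t' t'P]|nt] := classic (good (n + 1) t); first by exists t'.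
  by exists (t0 n).
pose fix approx (k : nat) (n : int) {struct k} : T n :=
  if k is k'.+1 then
    if N <= n then t0 n else sval (extend n (approx k' (n + 1)))
  else t0 n.
have approx0 k n : N <= n -> approx k n = t0 n by case: k => //= k ->.
pose t n := approx (absz (N - n)%R) n; exists t.
have tE n : N <= n -> t n = t0 n by exact: approx0.
have tS n : n < N -> t n = sval (extend n (t (n + 1))).
  move=> nN; rewrite /t; have -> : absz (N - n)%R = (absz (N - (n + 1))%R).+1 by lia.
  by rewrite /= ifF //; lia.
have tgood (k : nat) : forall n, N - n <= k%:Z -> good n (t n) /\ link n (t n) (t (n + 1)).
  elim: k => [|k IH] n nk.
    by rewrite !tE; [apply: t0P | |]; lia.
  have [Nn|nN] := leP N n; first by apply: IH; lia.
  rewrite tS //; apply: (svalP (extend n (t (n + 1)))).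
  by apply: (proj1 (IH _ _)); lia.
by move=> n; apply: (tgood (absz (N - n)%R)); lia.
Qed.

(** * Construction of the resolution *)

Section Resolution.
Variables (A : abelian_category).
Variables (C : bicomplex A) (Cup : upper_half_plane C).
Variable S : forall n : int, direct_sum (fun q : diag n => C (dcol q) (drow q)).
Implicit Types W : A.

Local Notation d n := (tot_d S n).
Local Notation E := (vert_coh C).

Hypothesis Eproj : forall i j : int, projective (E i j).
Variable s : int -> int.
Hypothesis s_incr : forall m n : int, m < n -> s m < s n.
Hypothesis E_support : forall i j : int,
  ~~ (s (i + j - 1) < i <= s (i + j)) -> is_zero (E i j).

Variable P : forall n : int, direct_sum (fun q : diag n => E (dcol q) (drow q)).
Variable l : forall i j : int, Mor (E i j) (C i j).
Hypothesis lP : forall i j : int, represents (K := column C i) (n := j) (l i j).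

Lemma s_mono (m n : int) : m <= n -> s m <= s n.
Proof. by rewrite le_eqVlt => /orP [/eqP ->|/s_incr /ltW]. Qed.

Lemma E_right (n i j : int) : i + j <= n -> s n < i -> is_zero (E i j).
Proof. by move=> /s_mono sn ni; apply: E_support; lia. Qed.

Lemma E_left (n i j : int) : n < i + j -> i <= s n -> is_zero (E i j).
Proof.
move=> nij ni; apply: E_support.
by have : s n <= s (i + j - 1) by [apply: s_mono; lia]; lia.
Qed.

Lemma P_above (n p : int) W (w : Mor W (P n)) : s n < p -> inF P p w -> w = 0.
Proof.
move=> np; apply: inF_eq0 => -[i j ij] /= pi.
by apply: (@E_right n); lia.
Qed.

Lemma P_below (n p : int) W (w : Mor W (P n)) : p <= s (n - 1) + 1 -> inF P p w.
Proof.
move=> pn; apply: inF_all => -[i j ij] /= ip.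
by apply: (@E_left (n - 1)); lia.
Qed.

Lemma l_v (i j : int) : bi_v C i j ∘ l i j = 0.
Proof. exact: represents_d (lP i j). Qed.

(** The leading terms of [psi] represent the vertical cohomology, and [psi] is
    a cocycle modulo the columns to the right of the [n]-th block. *)
Definition adapted n (psi : Mor (P n) (S n)) :=
  (forall q : diag n, inF S (dcol q) (psi ∘ ds_in (P n) q) /\
     component S q ∘ (psi ∘ ds_in (P n) q) = l (dcol q) (drow q)) /\
  inF S (s n + 1) (d n ∘ psi).

(** In the columns up to [s n] that follow [dcol q] there is no vertical
    cohomology of total degree [n + 1], so the differential of the representing
    cocycle can be pushed past column [s n]. *)
Lemma adapted_summand n (q : diag n) :
  exists f : Mor (E (dcol q) (drow q)) (S n),
    [/\ inF S (dcol q) f, component S q ∘ f = l (dcol q) (drow q)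
      & inF S (s n + 1) (d n ∘ f)].
Proof.
have [qs|sq] := leP (dcol q) (s n); last first.
  have E0 : is_zero (E (dcol q) (drow q)).
    by apply: (@E_right n) => //; rewrite diagE.
  exists 0; rewrite !comp0r; split; try exact: inF0.
  exact/esym/from_zero.
pose f0 := ds_in (S n) q ∘ l (dcol q) (drow q).
have df0F : inF S (dcol q + 1) (d n ∘ f0).
  rewrite /f0 comp_assoc tot_d_in comp_addl -!comp_assoc l_v !comp0r addr0.
  exact: inF_in.
have [|||y [yF dyF]] := remove_leading_terms (p' := s n + 1) (@Eproj _ _) _ _ df0F.
- by lia.
- by move=> i j ij _ isn; apply: (@E_left n); lia.
- by rewrite tot_dd0; apply: inF0.
exists (f0 - y); split.
- by apply: inFB; [apply: inF_in | apply: (inF_le _ yF); lia].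
- rewrite compBr comp_assoc component_in comp_idl (component_inF _ yF) ?subr0 //.
  by lia.
- by rewrite compBr.
Qed.

Lemma adapted_exists n : exists psi : Mor (P n) (S n), adapted psi.
Proof.
pose f q := constructive_indefinite_description _ (@adapted_summand n q).
have psiE q : ds_desc (P n) (fun q => sval (f q)) ∘ ds_in (P n) q = sval (f q).
  exact: (ds_descE (P n)).
exists (ds_desc (P n) (fun q => sval (f q))); split=> [q|].
  by rewrite psiE; case: (svalP (f q)).
apply: ds_ext => q; rewrite -!comp_assoc psiE.
by case: (svalP (f q)).
Qed.

Lemma adapted_inF n (psi : Mor (P n) (S n)) p W (w : Mor W (P n)) :
  adapted psi -> inF P p w -> inF S p (psi ∘ w).
Proof.
move=> [psiP _]; apply: filtered_map => q pq.
by apply: inF_le pq _; case: (psiP q).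
Qed.

Lemma adapted_component n (psi : Mor (P n) (S n)) q W (w : Mor W (P n)) :
  adapted psi -> inF P (dcol q) w ->
  component S q ∘ (psi ∘ w) = l (dcol q) (drow q) ∘ (component P q ∘ w).
Proof.
move=> psiP wF; rewrite {1}(inF_split wF) !comp_addr.
rewrite (@component_inF _ _ _ (dcol q + 1)); last 2 first.
- by lia.
- by apply: adapted_inF => //; apply/inF_comp/inF_truncation.
by rewrite add0r !comp_assoc -(comp_assoc _ psi) (proj2 (proj1 psiP q)).
Qed.

(** In each column [<= s (n + 1)] the leading term of [x] is a vertical
    cocycle; its class is realised by [psi], which leaves a vertical
    coboundary.  Subtracting [psi] spoils neither hypothesis on [x], because
    [psi] is a cocycle modulo [F^(s (n + 1) + 1)]. *)
Lemma approximate (n p : int) (psi : Mor (P (n + 1)) (S (n + 1))) W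
    (x : Mor W (S (n + 1))) :
  projective W -> adapted psi -> p <= s (n + 1) + 1 ->
  inF S p x -> inF S (s (n + 1) + 1) (d (n + 1) ∘ x) ->
  exists z t, inF S p t /\ inF S (s (n + 1) + 1) (x - psi ∘ z - d n ∘ t).
Proof.
move=> Wproj psiP; have [_ dpsi] := psiP.
move: {2}(absz (s (n + 1) + 1 - p)%R) (erefl (absz (s (n + 1) + 1 - p)%R)) => k.
elim: k p x => [|k IH] p x kE ps xF dxF.
  exists 0, 0; split; first exact: inF0.
  by rewrite !comp0r !subr0; apply: (inF_le _ xF); lia.
pose q := diag_at n p.
have vx0 : bi_v C p (n - p + 1) ∘ (component S (diag_v q) ∘ x) = 0.
  rewrite -(component_d (q := diag_v q)) //.
  by apply: (component_inF (q := diag_v (diag_v q)) _ dxF); rewrite /=; lia.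
have [z [y yE]] := represents_surj (K := column C p) Wproj (lP p (n - p + 1)) vx0.
pose w := ds_in (P (n + 1)) (diag_v q) ∘ z; pose u := ds_in (S n) q ∘ y.
have wF : inF P p w by exact: (inF_in P (q := diag_v q)).
have uF : inF S p u by exact: (inF_in S (q := q)).
have xF' : inF S (p + 1) (x - psi ∘ w - d n ∘ u).
  apply: (inF_succ (q := diag_v q)).
    by apply: inFB; [apply: inFB => //; apply: adapted_inF | apply: inF_d].
  rewrite !compBr component_d_in (adapted_component (q := diag_v q)) //.
  by rewrite (comp_assoc (component P _)) component_in comp_idl [X in X - _]yE subrr.
have [|||z' [t' [t'F x'F]]] := IH (p + 1) _ _ _ xF'; try by lia.
  rewrite !compBr tot_dd0 subr0; apply: inFB => //.
  by rewrite comp_assoc; apply: inF_comp.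
exists (w + z'), (u + t'); split.
  by apply: inFD => //; apply: (inF_le _ t'F); lia.
by rewrite !comp_addr opprD !addrA opprD addrA (addrAC _ _ (- (d n ∘ u))).
Qed.

(** Compare leading terms in column [p]: the class of that of [psi w] is the
    component of [w], while that of [d u] is a vertical coboundary.  So the
    component of [w] vanishes; then the leading term of [u] is a vertical
    cocycle in a column without cohomology of total degree [n + 1], and [u] can
    be moved to the right as well. *)
Lemma adapted_inj (n p : int) (psi : Mor (P (n + 1 + 1)) (S (n + 1 + 1))) W
    (u : Mor W (S (n + 1))) (w : Mor W (P (n + 1 + 1))) :
  projective W -> adapted psi -> s (n + 1) < p -> inF P p w -> inF S p u ->
  inF S (s (n + 1 + 1) + 1) (d (n + 1) ∘ u - psi ∘ w) -> w = 0.
Proof.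
move=> Wproj psiP.
move: {2}(absz (s (n + 1 + 1) + 1 - p)%R) (erefl (absz (s (n + 1 + 1) + 1 - p)%R)) => k.
elim: k p u => [|k IH] p u kE sp wF uF duF.
  by apply: P_above wF; lia.
have [ps|sp'] := leP p (s (n + 1 + 1)); last exact: P_above wF.
pose q := diag_at n p.
have wF' : inF P (p + 1) w.
  apply: (inF_succ (q := diag_v (diag_v q))) => //.
  have := component_inF (q := diag_v (diag_v q)) _ duF.
  rewrite compBr (component_d (q := diag_v q)) //.
  rewrite (adapted_component (q := diag_v (diag_v q))) //= => /(_ ltac:(lia)) lw.
  apply: (represents_inj (K := column C p) Wproj (lP p (n - p + 1 + 1))).
  by apply/esym/eqP; rewrite -subr_eq0; apply/eqP/lw.
have duF' : inF S (p + 1) (d (n + 1) ∘ u).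
  rewrite -[_ ∘ u](subrK (psi ∘ w)); apply: inFD; last exact: adapted_inF.
  by apply: (inF_le _ duF); lia.
have [|t [_ utF]] := remove_leading_term (q := q) Wproj _ uF duF'.
  by apply: (@E_right (n + 1)); rewrite /=; lia.
apply: (IH (p + 1) _ _ _ wF' utF); try by lia.
by rewrite compBr tot_dd0 subr0.
Qed.

(** The pairs consist of a differential of [P] and a component of [psi]. *)
Definition linked n (d0 : Mor (P n) (P (n + 1)) * Mor (P n) (S n))
    (d1 : Mor (P (n + 1)) (P (n + 1 + 1)) * Mor (P (n + 1)) (S (n + 1))) :=
  d1.2 ∘ d0.1 = d n ∘ d0.2 /\ d1.1 ∘ d0.1 = 0.

(** [approximate] leaves a remainder [r] in [F^(s (n + 1) + 1)] with
    [d r = - psi (dP z)]; then [adapted_inj] gives [dP z = 0].  So [r] is a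
    cocycle in columns without cohomology of total degree [n + 1], and it
    bounds. *)
Lemma resolve_cocycle (n : int) dpsi1 dpsi2 W (x : Mor W (S (n + 1))) :
  projective W -> adapted dpsi1.2 -> adapted dpsi2.2 -> linked (n := n + 1) dpsi1 dpsi2 ->
  inF S (s n + 1) x -> d (n + 1) ∘ x = 0 ->
  exists z y, [/\ inF S (s n + 1) y, x - dpsi1.2 ∘ z = d n ∘ y & dpsi1.1 ∘ z = 0].
Proof.
move=> Wproj ad1 ad2 [psi_d _] xF dx.
have sn : s n < s (n + 1) by apply: s_incr; lia.
have [||z [t [tF rF]]] := approximate (n := n) (p := s n + 1) Wproj ad1 _ xF.
- by lia.
- by rewrite dx; apply: inF0.
set r := (X in inF S _ X) in rF.
have dr : d (n + 1) ∘ r = - (dpsi2.2 ∘ (dpsi1.1 ∘ z)).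
  by rewrite !compBr dx tot_dd0 subr0 sub0r !comp_assoc psi_d.
have dz : dpsi1.1 ∘ z = 0.
  apply: (adapted_inj (p := s (n + 1) + 1) (u := - r) Wproj ad2).
  - by lia.
  - by apply: P_below; rewrite addrK.
  - by rewrite -sub0r; apply: inFB => //; apply: inF0.
  - by rewrite compNr dr opprK subrr; apply: inF0.
(* Any column beyond [n + 1] and the block will do. *)
pose M := s (n + 1) + 2 + absz (s (n + 1))%R + absz n.
have [|||y [yF ryF]] := remove_leading_terms (p' := M) Wproj _ _ rF.
- by rewrite /M; lia.
- by move=> i j ij si _; apply: (@E_right (n + 1)); lia.
- by rewrite dr dz comp0r oppr0; apply: inF0.
have ry : r = d n ∘ y.
  by apply/eqP; rewrite -subr_eq0; apply/eqP; apply: inF_upper ryF => //; rewrite /M; lia.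
exists z, (t + y); split=> //; first by apply: inFD => //; apply: (inF_le _ yF); lia.
by rewrite comp_addr -ry subrKC.
Qed.

Lemma resolution_exists (N : int) :
  (forall n, N <= n -> is_zero (P n)) ->
  exists t : forall n, Mor (P n) (P (n + 1)) * Mor (P n) (S n),
    forall n, adapted (t n).2 /\ linked (t n) (t (n + 1)).
Proof.
move=> P0; pose T n := (Mor (P n) (P (n + 1)) * Mor (P n) (S n))%type.
(* [resolve_cocycle] in degree [n + 1] looks at degree [n + 2] as well. *)
pose good n (t : T n) := adapted t.2 /\
  exists t' : T (n + 1), adapted t'.2 /\ linked t t'.
have zero_adapted n : N <= n -> adapted (0 : Mor (P n) (S n)).
  move=> Nn; have [psi] := adapted_exists n.
  by rewrite (from_zero psi (P0 n Nn)).
have zero_linked n : linked (n := n) (0, 0) (0, 0).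
  by split=> /=; rewrite ?comp0r.
have [|n t [ad1 [t' [ad2 lk]]]|t tP] := @backward_choice T good (@linked) N (fun n => (0, 0)).
- move=> n Nn; split; last exact: zero_linked.
  split; first exact: zero_adapted.
  by exists (0, 0); split; [apply: zero_adapted; lia | apply: zero_linked].
- have [phi [phiP dphiF]] := adapted_exists n.
  have [|z [y [yF psiz dz]]] := resolve_cocycle
    (direct_sum_projective (D := P n) (fun q => @Eproj _ _)) ad1 ad2 lk dphiF.
    exact: tot_dd0.
  have lk0 : linked (n := n) (z, phi - y) t.
    by split=> //=; rewrite compBr -psiz subKr.
  have ad0 : adapted (phi - y).
    split=> [q|]; last first.
      rewrite compBr; apply: inFB => //; exact: inF_d.
    have yqF : inF S (s n + 1) (y ∘ ds_in (P n) q) by apply: inF_comp.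
    rewrite compBl compBr; have [phiqF ->] := phiP q.
    have [qs|sq] := leP (dcol q) (s n).
      rewrite (component_inF _ yqF) ?subr0; last by lia.
      by split=> //; apply: inFB => //; apply: (inF_le _ yqF); lia.
    have E0 : is_zero (E (dcol q) (drow q)).
      by apply: (@E_right n) => //; rewrite diagE.
    split; last by rewrite [LHS](from_zero _ E0) [RHS](from_zero _ E0).
    by rewrite /inF [LHS](from_zero _ E0) [RHS](from_zero _ E0).
  by exists (z, phi - y); split=> //; split=> //; exists t.
by exists t => n; have [[]] := tP n.
Qed.

End Resolution.

(** * Comparison with the total complex *)

Section Comparison.
Variables (A : abelian_category) (enoughP : enough_projectives A).
Variables (C : bicomplex A) (Cup : upper_half_plane C).
Variable S : forall n : int, direct_sum (fun q : diag n => C (dcol q) (drow q)).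
Hypothesis conv : ss_converges (column_filtration S).
Variable s : int -> int.
Hypothesis s_incr : forall m n : int, m < n -> s m < s n.
Hypothesis E_support : forall i j : int,
  ~~ (s (i + j - 1) < i <= s (i + j)) -> is_zero (vert_coh C i j).
Variable P : forall n : int, direct_sum (fun q : diag n => vert_coh C (dcol q) (drow q)).
Variable l : forall i j : int, Mor (vert_coh C i j) (C i j).
Hypothesis lP : forall i j : int, represents (K := column C i) (n := j) (l i j).
Variable t : forall n, Mor (P n) (P (n + 1)) * Mor (P n) (S n).
Hypothesis tP : forall n, adapted s l (t n).2 /\ linked (t n) (t (n + 1)).

Lemma comparison_dd n : (t (n + 1)).1 ∘ (t n).1 = 0.
Proof. by have [_ []] := tP n. Qed.

Definition comparison_source : complex A := Complex comparison_dd.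

Lemma comparison_d n : (t (n + 1)).2 ∘ cx_d comparison_source n = tot_d S n ∘ (t n).2.
Proof. by have [_ []] := tP n. Qed.

Definition comparison : chain_map comparison_source (total_complex S) :=
  @ChainMap _ comparison_source (total_complex S) (fun n => (t n).2) comparison_d.

(** A cocycle moves into the columns [> s (n + 1)], those of the blocks from
    [n + 2] on, where [resolve_cocycle] applies. *)
Lemma comparison_surj n W (x : Mor W (S (n + 1 + 1))) :
  projective W -> tot_d S (n + 1 + 1) ∘ x = 0 ->
  exists (z : Mor W (P (n + 1 + 1))) (y : Mor W (S (n + 1))),
    (t (n + 1 + 1)).1 ∘ z = 0 /\ x - (t (n + 1 + 1)).2 ∘ z = tot_d S (n + 1) ∘ y.
Proof.
move=> Wproj dx; have [ad1 lk] := tP (n + 1 + 1); have [ad2 _] := tP (n + 1 + 1 + 1).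
have [|x' [y [x'F dx' xx']]] :=
  cocycle_push (p := s (n + 1) + 1) enoughP conv _ Wproj dx.
  by move=> i j ij is1; apply: (E_left s_incr E_support (n := n + 1)); lia.
have [z [y' [_ x'z dz]]] :=
  resolve_cocycle Cup s_incr E_support lP Wproj ad1 ad2 lk x'F dx'.
exists z, (y + y'); split=> //.
by rewrite comp_addr -xx' -x'z addrA subrK.
Qed.

(** If [psi z] bounds, it bounds an element [c] of the columns [> s n].  The
    part of [c] in the block [n + 1] is [psi z'] up to a coboundary, and the
    difference between [z] and the differential of [z'] is then killed by
    [adapted_inj]. *)
Lemma comparison_inj n W (z : Mor W (P (n + 1 + 1))) (y : Mor W (S (n + 1))) :
  projective W -> (t (n + 1 + 1)).1 ∘ z = 0 ->
  (t (n + 1 + 1)).2 ∘ z = tot_d S (n + 1) ∘ y ->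
  exists z', z = (t (n + 1)).1 ∘ z'.
Proof.
move=> Wproj dz psiz; have [wconv _ _] := conv.
have [ad1 [psi_d _]] := tP (n + 1); have [ad2 _] := tP (n + 1 + 1).
have sn : s n < s (n + 1) by apply: s_incr; lia.
have psizF : inF S (s (n + 1) + 1) ((t (n + 1 + 1)).2 ∘ z).
  by apply: (adapted_inF ad2); apply: (P_below s_incr E_support); rewrite addrK.
have [||c [cF psizc]] := bounding_push (p := s n + 1) enoughP Cup wconv _ Wproj _ psiz.
- by move=> i j ij isn; apply: (E_left s_incr E_support (n := n)); lia.
- by apply: (inF_le _ psizF); lia.
have [||z' [u [_ rF]]] := approximate lP Wproj ad1 _ cF _.
- by rewrite lerD2r ltW.
- by rewrite -psizc.
exists z'; apply/eqP; rewrite -subr_eq0; apply/eqP.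
apply: (adapted_inj s_incr E_support lP Wproj ad2 _ _ rF).
- by lia.
- by apply: (P_below s_incr E_support); rewrite addrK.
rewrite !compBr tot_dd0 subr0 -psizc !comp_assoc psi_d.
by rewrite [X in inF _ _ X](_ : _ = 0); [apply: inF0 | rewrite opprB addrA subrK subrr].
Qed.

Lemma comparison_quasi_iso : quasi_iso comparison.
Proof.
move=> m; have [n ->] : exists n, m = n + 1 + 1 by exists (m - 1 - 1); lia.
apply: induced_iso_projective => // [W x|W z y]; first exact: comparison_surj.
exact: comparison_inj.
Qed.

End Comparison.

(** * The blocks of columns *)

Section Blocks.
Variables (a : int) (s : int -> int).
Hypothesis s_decr : forall m n : int, m < n -> n <= a -> s m < s n.

Lemma block_exists (i : int) :
  i <= s a -> exists n : int, [/\ n <= a, s (n - 1) < i & i <= s n].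
Proof.
suff descend (k : nat) (n : int) : n <= a -> i <= s n -> s n - i <= k%:Z ->
    exists n : int, [/\ n <= a, s (n - 1) < i & i <= s n].
  by move=> ia; apply: (descend (absz (s a - i)%R) a) => //; lia.
elim: k n => [|k IH] n na isn kn;
  (have sn : s (n - 1) < s n by apply: s_decr => //; lia).
  by exists n; split=> //; lia.
have [ln|nl] := ltP (s (n - 1)) i; first by exists n.
by apply: (IH (n - 1)); lia.
Qed.

(** Beyond [a] any strictly increasing continuation works, since there is no
    vertical cohomology in the columns [> s a]. *)
Definition extended_bound (n : int) : int := if n <= a then s n else s a + (n - a).

Lemma extended_bound_incr (m n : int) : m < n -> extended_bound m < extended_bound n.
Proof.
rewrite /extended_bound => mn; case: (leP m a) => ma; case: (leP n a) => na; try lia.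
  exact: s_decr.
have [->|/eqP nma] := eqVneq m a; first by lia.
by have := s_decr (m := m) (n := a); lia.
Qed.

End Blocks.

Theorem proposition4p4 (A : abelian_category) (enoughP : enough_projectives A)
    (C : bicomplex A) (Cup : upper_half_plane C)
    (S : forall n : int, direct_sum (fun q : diag n => C (dcol q) (drow q)))
    (conv : ss_converges (column_filtration S))
    (E1proj : forall i j : int, projective (vert_coh C i j))
    (a : int) (s : int -> int)
    (s_decr : forall m n : int, m < n -> n <= a -> s m < s n)
    (E1_right : forall i j : int, s a < i -> is_zero (vert_coh C i j))
    (E1_diag : forall n i j : int, n <= a -> s (n - 1) < i -> i <= s n ->
      i + j <> n -> is_zero (vert_coh C i j)) :
  exists Psum : forall n : int,
      direct_sum (fun q : diag n => vert_coh C (dcol q) (drow q)),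
    (forall n : int, projective (Psum n)) /\
    (forall n : int, a < n -> is_zero (Psum n)) /\
    exists (dP : forall n : int, Mor (Psum n) (Psum (n + 1)))
           (dPdP : forall n : int, (dP (n + 1) ∘ dP n)%cat = 0),
      let P := @Complex A (fun n => Psum n) dP dPdP in
      bounded_above_projective P /\
      exists psi : chain_map P (total_complex S),
        quasi_iso psi /\ projective_resolution psi.
Proof.
pose b := extended_bound a s.
have b_incr := extended_bound_incr s_decr.
(* A column [i <= s a] belongs to a block of degree [<= a]. *)
have E0 i j : a < i + j -> is_zero (vert_coh C i j).
  have [/(block_exists s_decr) [n [na ni im]] aij|/E1_right //] := leP i (s a).
  by apply: (E1_diag n) => //; lia.
have E_support i j : ~~ (b (i + j - 1) < i <= b (i + j)) -> is_zero (vert_coh C i j).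
  have [ij|] := leP (i + j) a; last by move=> /E0.
  rewrite /b /extended_bound !ifT //; last by lia.
  have [/(block_exists s_decr) [n [na ni im]] out|/E1_right //] := leP i (s a).
  by apply: (E1_diag n) => // ijn; move: out; rewrite ijn ni im.
have Psum_ex n : exists D : direct_sum (fun q : diag n => vert_coh C (dcol q) (drow q)), True.
  have [|D] := @direct_sum_finite A n (fun q => vert_coh C (dcol q) (drow q))
    (b (n - 1) + 1) (absz (b n - b (n - 1))%R); last by exists D.
  move=> [i j ij] /= out; apply: E_support; rewrite ij.
  have bn : b (n - 1) < b n by apply: b_incr; lia.
  by move: (b (n - 1)) (b n) bn out => u v; lia.
pose Psum n := sval (constructive_indefinite_description _ (Psum_ex n)).
have Psum_proj n : projective (Psum n) by apply: direct_sum_projective.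
have Psum0 n : a < n -> is_zero (Psum n).
  by move=> an; apply: direct_sum_zero => -[i j /= ij]; apply: E0; rewrite ij.
have rep (ij : int * int) := constructive_indefinite_description _
  (represents_exists (K := column C ij.1) (E1proj ij.1 ij.2)).
pose l i j := sval (rep (i, j)).
have lP i j : represents (K := column C i) (n := j) (l i j) := svalP (rep (i, j)).
have [|t tP] := resolution_exists Cup S E1proj b_incr E_support (P := Psum) lP (N := a + 1).
  by move=> n an; apply: Psum0; lia.
exists Psum; split=> //; split=> //.
exists (fun n => (t n).1), (comparison_dd tP).
have Pbound : bounded_above_projective (comparison_source tP).
  by split=> //; exists a.
split=> //; exists (comparison tP).
have quis := comparison_quasi_iso enoughP Cup conv b_incr E_support lP tP.
by split.
Qed.
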